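(* Let $N=p^r$ with $p$ an odd prime and $r\ge2$, let $A$ be $\mathbf{Q}$ or $\mathbf{Q}/\mathbf{Z}$, let $f:\mathcal{S}\to A$ be a map, and let $a\in\mathbf{Z}_{\ge1}$. Suppose that all the following hold. (1) $\Psi(f)(m,h)=0$ for all $(m,h)\in\mathcal{S}$. (2) $f(m,h)=0$ for all $(m,h)\in\mathcal{S}\setminus\mathcal{A}(a)$. Then $f(m,h)=0$ for all $(m,h)\in\mathcal{S}$.
   Context: For a positive divisor $m$ of $N=p^r$, $\ell(m)$ is the largest integer whose square divides $N/m$. $\mathcal{D}_N$ is the set of positive divisors of $N$ different from $N$, and $\mathcal{S}=\{(m,h)\in\mathcal{D}_N\times\mathbf{Z}:1\le h\le\ell(m)\}$. $v_p$ is the $p$-adic valuation, and $\mathcal{A}(a)=\{(m,h)\in\mathcal{S}:v_p(h)=v_p(\ell(m))-a\}$. For $\mathfrak{m}\in\mathcal{D}_N$ with $p\mid\ell(\mathfrak{m})$ and $f:\mathcal{S}\to A$ define $\Psi_{\mathfrak{m}}(f):\mathcal{S}\to A$ by $$\Psi_{\mathfrak m}(f)(m,h)=\begin{cases}f(m,h)-f(\mathfrak m,h')&\text{if } m=\mathfrak m,\\ f(m,h)+f(\mathfrak m,p^{-\varepsilon}h)&\text{if } m=\mathfrak mp\text{ and }p^{\varepsilon}\mid h,\\ f(m,h)&\text{otherwise},\end{cases}$$ where $h'$ is the smallest positive integer congruent to $h$ modulo $\ell(\mathfrak m)/p$ and $\varepsilon=1+v_p(\ell(\mathfrak mp))-v_p(\ell(\mathfrak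 m))$. Then $$\Psi(f)=\Psi_{p^{r-2}}\circ\Psi_{p^{r-3}}\circ\cdots\circ\Psi_p\circ\Psi_1(f).$$ *)

(* Defs.v *)
From HB Require Import structures.
From mathcomp Require Import all_boot all_order all_algebra zify.
Set Implicit Arguments.
Unset Strict Implicit.
Unset Printing Implicit Defensive.
Import Order.TTheory GRing.Theory Num.Theory.
Local Open Scope ring_scope.

(* The additive group Q/Z; Num.int_num_subdef is the predicate underlying
   Num.int. *)
Definition ratZ : zmodType :=
  Quotient.quot (GRing.ZmodClosed.clone rat (@Num.int_num_subdef rat) _).

Lemma eq_ratZ (x y : rat) :
  reflect ((\pi x)%qT = (\pi y)%qT :> ratZ) (x - y \is a Num.int).
Proof. by rewrite [_ \is a _]Quotient.idealrBE; apply: eqP. Qed.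

Section Index.
Local Open Scope nat_scope.

(* The bound d <= N / m loses nothing, since d <= d ^ 2 <= N / m. *)
Definition ell (N m : nat) : nat :=
  \max_(d < (N %/ m).+1 | d ^ 2 %| N %/ m) d.

Definition DN (N : nat) : pred nat :=
  [pred m | [&& 0 < m, m %| N & m != N]].

(* Since 1 <= h, the second component can be taken in nat instead of int. *)
Definition inS (N : nat) : pred (nat * nat) :=
  [pred x | (x.1 \in DN N) && (1 <= x.2 <= ell N x.1)].

Definition SN (N : nat) : Type := {x : nat * nat | inS N x}.

Definition Sm (N : nat) (s : SN N) : nat := (val s).1.
Definition Sh (N : nat) (s : SN N) : nat := (val s).2.

(* The equality is taken in int, because nat subtraction truncates at 0. *)
Definition calA (p N a : nat) : pred (SN N) :=
  [pred s | (logn p (Sh s))%:Z == ((logn p (ell N (Sm s)))%:Z - a%:Z)%R].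

Lemma Sh_gt0 (N : nat) (s : SN N) : 0 < Sh s.
Proof. by have /andP[_ /andP[]] := valP s. Qed.

Lemma ex_pos_congr (q h : nat) :
  0 < h -> exists n, (0 < n) && (n == h %[mod q]).
Proof. by move=> h0; exists h; rewrite h0 eqxx. Qed.

(* The smallest positive integer congruent to h modulo q. *)
Definition least_pos_congr (q h : nat) (h_gt0 : 0 < h) : nat :=
  ex_minn (ex_pos_congr q h_gt0).

(* For p dividing ell N m this is a genuine (non-truncated) subtraction when
   N and m are powers of p, see eps_subK. *)
Definition eps (p N m : nat) : nat :=
  1 + logn p (ell N (m * p)) - logn p (ell N m).

End Index.

Arguments calA p N a _ : clear implicits.

Section Psi.
Variables (p N : nat) (A : zmodType).

(* Extension of f by 0 outside S; Psi1 evaluates it only at points of S, see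
   Psi1_inS1 and Psi1_inS2. *)
Definition ext (f : SN N -> A) (x : nat * nat) : A :=
  if insub x is Some s then f s else 0.

Definition Psi1 (mm : nat) (f : SN N -> A) : SN N -> A := fun s =>
  if Sm s == mm then
    f s - ext f (mm, least_pos_congr (ell N mm %/ p)%N (Sh_gt0 s))
  else if (Sm s == mm * p)%N && (p ^ eps p N mm %| Sh s)%N then
    f s + ext f (mm, Sh s %/ p ^ eps p N mm)%N
  else f s.

End Psi.

(* iota 0 r.-1 is [0; ...; r - 2], and foldl applies the operator of index 0
   first. *)
Definition Psi (p r : nat) (A : zmodType) (f : SN (p ^ r)%N -> A) :
    SN (p ^ r)%N -> A :=
  foldl (fun g i => Psi1 p (p ^ i)%N g) f (iota 0 r.-1).

Arguments Psi p r {A} f s.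

Section Facts.
Local Open Scope nat_scope.

Lemma ext_val (N : nat) (A : zmodType) (f : SN N -> A) (s : SN N) :
  ext f (val s) = f s.
Proof. by rewrite /ext valK. Qed.

Lemma ell_sqr_dvd (N m : nat) : 0 < N %/ m -> ell N m ^ 2 %| N %/ m.
Proof.
move=> h; have h1 : 1 < (N %/ m).+1 by rewrite ltnS.
rewrite /ell (bigop.bigmax_eq_arg (Ordinal h1)) ?exp1n ?dvd1n //.
by case: arg_maxnP; rewrite //= exp1n dvd1n.
Qed.

Lemma leq_ell (N m d : nat) : 0 < N %/ m -> d ^ 2 %| N %/ m -> d <= ell N m.
Proof.
move=> h hd; have dle : d < (N %/ m).+1.
  rewrite ltnS; apply: leq_trans (dvdn_leq h hd).
  by case: d {hd} => // d; rewrite -mulnn leq_pmulr.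
by rewrite /ell -[d in d <= _]/(val (Ordinal dle)); apply: (leq_bigmax_cond (F := val)).
Qed.

Lemma ell_pexp (p r i : nat) : prime p -> i <= r ->
  ell (p ^ r) (p ^ i) = p ^ (r - i)./2.
Proof.
move=> pp ir; have p0 := prime_gt0 pp.
have E : p ^ r %/ p ^ i = p ^ (r - i) by rewrite -expnB ?prime_gt1.
have h : 0 < p ^ r %/ p ^ i by rewrite E expn_gt0 p0.
apply/eqP; rewrite eqn_leq; apply/andP; split; last first.
  apply: leq_ell => //; rewrite E -expnM dvdn_exp2l //.
  by rewrite muln2 -[leqRHS]odd_double_half leq_addl.
have := ell_sqr_dvd h; rewrite E => hd.
have /(dvdn_pfactor _ _ pp)[k _ Ek] : ell (p ^ r) (p ^ i) %| p ^ (r - i).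
  by apply: dvdn_trans hd; rewrite expnS dvdn_mulr.
move: hd; rewrite Ek -expnM dvdn_Pexp2l ?prime_gt1 // => hk.
rewrite leq_exp2l ?prime_gt1 //.
by rewrite -(half_double k) half_leq // -muln2.
Qed.

Lemma eps_subK (p r i : nat) : prime p -> i.+2 <= r ->
  eps p (p ^ r) (p ^ i) + logn p (ell (p ^ r) (p ^ i)) =
  1 + logn p (ell (p ^ r) (p ^ i * p)).
Proof.
move=> pp ir; have ir1 := ltnW ir; have ir0 := ltnW ir1.
rewrite /eps subnK // -expnSr !ell_pexp // !pfactorK // add1n.
by rewrite -[leqRHS]/((r - i.+1).+2)./2 half_leq // subnS; lia.
Qed.

Lemma dvdn_ell_pexp (p r i : nat) : prime p -> i <= r ->
  (p %| ell (p ^ r) (p ^ i)) = (i.+2 <= r).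
Proof.
move=> pp ir; rewrite ell_pexp // -{1}(expn1 p) dvdn_Pexp2l ?prime_gt1 //.
by rewrite half_gt0 ltn_subRL addn1.
Qed.

Lemma Psi1_inS1 (p N mm : nat) (s : SN N) :
  mm \in DN N -> prime p -> p %| ell N mm -> Sm s = mm ->
  inS N (mm, least_pos_congr (ell N mm %/ p) (Sh_gt0 s)).
Proof.
move=> mD pp pl sm; rewrite /inS /= mD /=.
have l0 : 0 < ell N mm.
  by rewrite -sm; have /andP[_ /andP[/leq_trans]] := valP s; apply.
have q0 : 0 < ell N mm %/ p by rewrite divn_gt0 ?(dvdn_leq l0 pl) // prime_gt0.
rewrite /least_pos_congr; case: ex_minnP => n /andP[-> _] /= nmin.
apply: leq_trans _ (leq_div _ p).
apply: leq_trans (nmin ((Sh s).-1 %% (ell N mm %/ p)).+1 _) _.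
  by rewrite /= -addn1 modnDml addn1 (prednK (Sh_gt0 s)).
by rewrite ltn_mod.
Qed.

Lemma Psi1_inS2 (p r i : nat) (s : SN (p ^ r)) :
  prime p -> i.+2 <= r -> Sm s = p ^ i * p ->
  p ^ eps p (p ^ r) (p ^ i) %| Sh s ->
  inS (p ^ r) (p ^ i, Sh s %/ p ^ eps p (p ^ r) (p ^ i)).
Proof.
move=> pp ir sm hd; have p0 := prime_gt0 pp.
have lt1 := ltnW ir; have le1 := ltnW lt1.
rewrite /inS /= inE expn_gt0 p0 /= dvdn_exp2l ?le1 //=.
rewrite eqn_exp2l ?prime_gt1 // (ltn_eqF lt1) /=.
rewrite divn_gt0 ?expn_gt0 ?p0 // (dvdn_leq (Sh_gt0 s) hd) /=.
apply: leq_trans (leq_div _ _) _.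
have : Sh s <= ell (p ^ r) (Sm s) by have /andP[_ /andP[]] := valP s.
move=> /leq_trans; apply; rewrite sm -expnSr !ell_pexp //.
by rewrite leq_exp2l ?prime_gt1 // half_leq // leq_sub2l.
Qed.

End Facts.

(* Main.v *)
Require Import Defs.
From mathcomp Require Import all_boot all_order all_algebra.
From mathcomp Require Import zify.
Import Order.TTheory GRing.Theory Num.Theory.
Local Open Scope ring_scope.

(** Write L_i for half of r - i, rounded down, so that the fibre of S over p^i is
    [1, p^L_i]. Reading h as the class of h / p^L_i turns this fibre into the
    p^L_i-torsion of Q/Z, and v_p(h) = L_i - b says that the class has order
    exactly p^b. In these coordinates the level-(i+1) part of Psi_{p^i} adds to
    f the value of f on a class y with p y = x, and the level-i part compares f
    at two classes that differ by an element of order dividing p.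

    Let g_i be the function on level i just before Psi_{p^i} is applied. The
    vanishing of Psi(f) says that g_i is invariant under translation by the
    p-torsion, for i <= r - 2; the step from level i to level i + 1 says
    g_{i+1}(p y) = f_{i+1}(p y) + g_i(y); and f_i lives on classes of order p^a
    only. All g_i vanish, by cases on the order p^b of the argument
    ([periodic_recursion_eq0]).

    - At the origin, f contributes nothing since a >= 1, and g_{i+1}(0) is the
      value of g_i on the p-torsion, which is g_i(0) by invariance; so
      g_i(0) = 0 for all i by induction on i.
    - For 1 <= b <= a, use induction on b: p y has order p^(b-1), where f
      vanishes, so g_i(y) = g_{i+1}(p y) = 0. The values of f of order p^a are
      thus pushed down, one order per level, until they reach the origin, where
      they are seen to be 0.
    - For b > a, f contributes nothing, and g_{i+1} at order p^b is either 0
      or a value of g_i at order p^(b+1); so it is 0 by induction on i.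

    Since all g_i vanish, so does f = g_{i+1} - (contribution of g_i). The
    remaining lemmas identify the g_i with the levels of the partial composites
    of the operators Psi_{p^i}: level j is touched only by the operators of
    index j - 1 and j. *)

(** * Valuations of integers in [1, p^n] *)

Lemma logn_le_exp (p n h : nat) :
  prime p -> (0 < h <= p ^ n)%N -> (logn p h <= n)%N.
Proof.
move=> pp /andP[h0 hle].
rewrite -(leq_exp2l _ _ (prime_gt1 pp)); apply: leq_trans hle.
by apply: dvdn_leq => //; rewrite pfactor_dvdn.
Qed.

Lemma logn_eq_exp (p n h : nat) :
  prime p -> (0 < h <= p ^ n)%N -> logn p h = n -> h = (p ^ n)%N.
Proof.
move=> pp /andP[h0 hle] hn; apply/eqP; rewrite eqn_leq hle /=.
by apply: dvdn_leq => //; rewrite pfactor_dvdn // hn.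
Qed.

(** With h' in [1, p^n] instead of [0, p^n - 1], the bound on the valuation of h
    may include the value n: then h' is p^n and not 0. *)
Lemma logn_modn_exp (p n h h' : nat) :
  prime p -> (0 < h)%N -> (0 < h' <= p ^ n)%N -> h' = h %[mod p ^ n] ->
  (logn p h <= n)%N -> logn p h' = logn p h.
Proof.
move=> pp h0 /[dup] hr /andP[h'0 _] hmod hn.
have hle := logn_le_exp p n h' pp hr.
have dvd_mod d : (d <= n)%N -> (p ^ d %| h')%N = (p ^ d %| h)%N.
  move=> dn; have hd : (p ^ d %| p ^ n)%N by apply: dvdn_exp2l.
  by rewrite /dvdn -(modn_dvdm h' hd) hmod modn_dvdm.
apply/eqP; rewrite eqn_leq.
by rewrite -!pfactor_dvdn // dvd_mod // -dvd_mod // !pfactor_dvdn // !leqnn.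
Qed.

(** * Vanishing for functions of a level and an integer *)

(** The heart of the proof, freed from the index type S: here [g] stands for the
    level-j values reached just before the j-th operator applies. *)
Lemma periodic_recursion_eq0 (p r a : nat) (A : zmodType)
    (F g : nat -> nat -> A)
    (L := fun j => ((r - j)./2)%N)
    (e := fun j => (1 + L j.+1 - L j)%N)
    (inR := fun j h => (0 < h <= p ^ L j)%N) :
  prime p -> (1 <= a)%N ->
  (forall h, inR 0%N h -> g 0%N h = F 0%N h) ->
  (forall j h, (j.+1 < r)%N -> inR j.+1 h ->
     g j.+1 h = F j.+1 h +
                if (p ^ e j %| h)%N then g j (h %/ p ^ e j)%N else 0) ->
  (forall j h, (j.+1 < r)%N -> inR j h ->
     exists2 h', (0 < h' <= p ^ (L j).-1)%N /\ h' = h %[mod p ^ (L j).-1]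
               & g j h = g j h') ->
  (forall j h, (j < r)%N -> inR j h -> (logn p h + a)%N <> L j -> F j h = 0) ->
  forall j h, (j < r)%N -> inR j h -> F j h = 0.
Proof.
move=> pp a1 g0E gSE gper Fsupp.
have p1 := prime_gt1 pp; have p0 := prime_gt0 pp.
have Le j : (j.+1 < r)%N -> (e j + L j = L j.+1 + 1)%N /\ (0 < L j)%N.
  by rewrite /e /L => jr; split; lia.
have L0 j : (j < r)%N -> (0 < L j)%N -> (j.+1 < r)%N by rewrite /L; lia.
(* Only Le and L0 are used of L and e; hiding the bodies keeps the halving
   out of the arithmetic below. *)
clearbody e; clearbody L.
have inR_top j : inR j (p ^ L j)%N by rewrite /inR expn_gt0 p0 leqnn.
have g_origin j : (j < r)%N -> g j (p ^ L j)%N = 0.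
  elim: j => [|j IH] jr.
    by rewrite g0E // Fsupp // pfactorK //; lia.
  have [eL Lj] := Le j jr.
  rewrite gSE // Fsupp // ?pfactorK //; last by lia.
  have -> : (p ^ L j.+1 = p ^ (L j).-1 * p ^ e j)%N.
    by rewrite -expnD; congr expn; lia.
  rewrite dvdn_mull // mulnK ?expn_gt0 ?p0 // add0r -(IH (ltnW jr)).
  have [h' [h'r h'mod] ->] := gper j _ jr (inR_top j).
  (* h' is divisible by p^(L j - 1) and at most p^(L j - 1). *)
  congr g; apply/esym/logn_eq_exp => //.
  apply/eqP; rewrite eqn_leq logn_le_exp //= -pfactor_dvdn //; last by lia.
  by rewrite /dvdn h'mod; apply: dvdn_exp2l; lia.
have g_low b : (b <= a)%N -> forall j h, (j < r)%N -> inR j h ->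
    (logn p h + b = L j)%N -> g j h = 0.
  elim: b => [|b IH] ba j h jr hr hb.
    by rewrite (logn_eq_exp p (L j) h) ?g_origin // -hb addn0.
  have jr1 : (j.+1 < r)%N by apply: L0 => //; lia.
  have [eL Lj] := Le j jr1.
  have [h' [h'r h'mod] ->] := gper j h jr1 hr.
  have vh' : logn p h' = logn p h.
    by apply: (logn_modn_exp p (L j).-1) => //; [case/andP: hr | lia].
  have /andP[h'0 h'le] := h'r.
  (* The point of level j.+1 at which the recursion reads off g j h'; it has
     order p^b, so F vanishes there because b < a. *)
  have kr : inR j.+1 (h' * p ^ e j)%N.
    rewrite /inR muln_gt0 h'0 expn_gt0 p0 /=.
    have -> : L j.+1 = ((L j).-1 + e j)%N by lia.
    by rewrite expnD leq_mul2r h'le orbT.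
  have vk : logn p (h' * p ^ e j)%N = (logn p h + e j)%N.
    by rewrite lognM ?expn_gt0 ?p0 // pfactorK // vh'.
  have := gSE j _ jr1 kr.
  rewrite dvdn_mull // mulnK ?expn_gt0 ?p0 // Fsupp // ?vk; last by lia.
  by rewrite add0r => <-; apply: IH => //; rewrite ?vk; lia.
have g_high j : (j < r)%N -> forall h, inR j h ->
    (logn p h + a < L j)%N -> g j h = 0.
  elim: j => [|j IH] jr h hr hb.
    by rewrite g0E // Fsupp //; lia.
  have [eL Lj] := Le j jr.
  rewrite gSE // Fsupp //; last by lia.
  case: ifP => [hd|_]; rewrite ?addr0 // add0r.
  have /andP[h0 hle] := hr.
  apply: IH; first exact: ltnW.
    rewrite /inR divn_gt0 ?expn_gt0 ?p0 // dvdn_leq //=.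
    rewrite leq_divLR // -expnD; apply: leq_trans hle _.
    by rewrite leq_exp2l //; lia.
  by rewrite logn_div // pfactorK //; move: hd; rewrite pfactor_dvdn //; lia.
have g_eq0 j h : (j < r)%N -> inR j h -> g j h = 0.
  move=> jr hr; have hL := logn_le_exp p (L j) h pp hr.
  have [la|la] := leqP (L j) (logn p h + a); last exact: g_high.
  by apply: (g_low (L j - logn p h)%N) => //; lia.
case=> [|j] h jr hr; first by rewrite -g0E // g_eq0.
have [eL Lj] := Le j jr; have /andP[h0 hle] := hr.
have := gSE j h jr hr; rewrite g_eq0 //; case: ifP => [hd|_]; last first.
  by rewrite addr0.
rewrite (g_eq0 j) ?addr0 ?(ltnW jr) //.
rewrite /inR divn_gt0 ?expn_gt0 ?p0 // dvdn_leq //=.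
rewrite leq_divLR // -expnD; apply: leq_trans hle _.
by rewrite leq_exp2l //; lia.
Qed.

(** * The operators on the fibres of S *)

Lemma inS_pexp (p r j h : nat) : prime p -> (j < r)%N ->
  inS (p ^ r)%N ((p ^ j)%N, h) = (0 < h <= p ^ ((r - j)./2))%N.
Proof.
move=> pp jr; rewrite /inS /= inE ell_pexp ?(ltnW jr) // expn_gt0 prime_gt0 //=.
by rewrite dvdn_exp2l ?(ltnW jr) // eqn_exp2l ?prime_gt1 // (ltn_eqF jr).
Qed.

Lemma Sm_pexp (p r : nat) (s : SN (p ^ r)%N) : prime p ->
  exists2 j, (j < r)%N & Sm s = (p ^ j)%N.
Proof.
move=> pp; have /andP[/and3P[_ md mN] _] := valP s.
have /(dvdn_pfactor _ _ pp)[j jr jE] := md.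
exists j => //; rewrite ltn_neqAle jr andbT.
by apply: contraNneq mN => jrE; rewrite jE jrE.
Qed.

Lemma ext_Sub (N : nat) (A : zmodType) (f : SN N -> A) (x : nat * nat)
    (xS : inS N x) : ext f x = f (exist _ x xS).
Proof. exact: (ext_val f (exist _ x xS)). Qed.

Lemma least_pos_congrP (q h : nat) (h0 : (0 < h)%N) : (0 < q)%N ->
  (0 < least_pos_congr q h0 <= q)%N /\ least_pos_congr q h0 = h %[mod q].
Proof.
move=> q0; rewrite /least_pos_congr.
case: ex_minnP => n /andP[n0 /eqP nh] nmin; split=> //; rewrite n0 /=.
apply: leq_trans (nmin (h.-1 %% q).+1 _) _; last by rewrite ltn_mod.
by rewrite /= -addn1 modnDml addn1 prednK.
Qed.

(** Of the reduced argument h' only its range and its congruence class are used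
    later, so it is hidden behind an existential; in particular, this avoids the
    positivity proof inside [least_pos_congr]. *)
Lemma ext_Psi1_base (p r j h : nat) (A : zmodType) (g : SN (p ^ r)%N -> A) :
  prime p -> (j.+1 < r)%N -> (0 < h <= p ^ (r - j)./2)%N ->
  exists2 h',
    (0 < h' <= p ^ ((r - j)./2).-1)%N /\ h' = h %[mod p ^ ((r - j)./2).-1]
    & ext (Psi1 p (p ^ j)%N g) ((p ^ j)%N, h)
      = ext g ((p ^ j)%N, h) - ext g ((p ^ j)%N, h').
Proof.
move=> pp jr hr; have jr0 := ltnW jr; have p0 := prime_gt0 pp.
have xS : inS (p ^ r)%N ((p ^ j)%N, h) by rewrite inS_pexp.
have qE : (ell (p ^ r) (p ^ j) %/ p = p ^ ((r - j)./2).-1)%N.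
  rewrite ell_pexp ?(ltnW jr0) //.
  have -> : ((r - j)./2 = ((r - j)./2).-1.+1)%N by lia.
  by rewrite expnS mulKn.
rewrite !(ext_Sub _ _ _ _ xS) /Psi1 /Sm /= eqxx.
set s := exist _ _ _; rewrite qE.
exists (least_pos_congr (p ^ ((r - j)./2).-1)%N (Sh_gt0 s)) => //.
by apply: least_pos_congrP; rewrite expn_gt0 p0.
Qed.

Lemma ext_Psi1_next (p r j h : nat) (A : zmodType) (g : SN (p ^ r)%N -> A)
    (e := (1 + (r - j.+1)./2 - (r - j)./2)%N) :
  prime p -> (j.+1 < r)%N -> (0 < h <= p ^ (r - j.+1)./2)%N ->
  ext (Psi1 p (p ^ j)%N g) ((p ^ j.+1)%N, h)
  = ext g ((p ^ j.+1)%N, h) +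
    if (p ^ e %| h)%N then ext g ((p ^ j)%N, (h %/ p ^ e)%N) else 0.
Proof.
move=> pp jr hr; have p1 := prime_gt1 pp.
have xS : inS (p ^ r)%N ((p ^ j.+1)%N, h) by rewrite inS_pexp.
have eE : eps p (p ^ r)%N (p ^ j)%N = e.
  have j0 : (j <= r)%N by lia.
  by rewrite /eps -expnSr !ell_pexp ?(ltnW jr) // !pfactorK.
rewrite !(ext_Sub _ _ _ _ xS) /Psi1 /Sm /Sh /= eqn_exp2l // eqn_leq ltnn /=.
rewrite -expnSr eqxx eE /=.
by case: ifP; rewrite ?addr0.
Qed.

Lemma ext_Psi1_far (p r i j h : nat) (A : zmodType) (g : SN (p ^ r)%N -> A) :
  prime p -> j != i -> j != i.+1 ->
  ext (Psi1 p (p ^ i)%N g) ((p ^ j)%N, h) = ext g ((p ^ j)%N, h).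
Proof.
move=> pp ji jSi; have p1 := prime_gt1 pp.
rewrite /ext; case: insubP => // s _ sE.
by rewrite /Psi1 /Sm sE /= -expnSr !eqn_exp2l // (negPf ji) (negPf jSi).
Qed.

(** * Partial composites *)

Definition Psi_upto (p r : nat) (A : zmodType) (f : SN (p ^ r)%N -> A)
    (k : nat) : SN (p ^ r)%N -> A :=
  foldl (fun g i => Psi1 p (p ^ i)%N g) f (iota 0 k).

Lemma Psi_uptoS (p r k : nat) (A : zmodType) (f : SN (p ^ r)%N -> A) :
  Psi_upto p r A f k.+1 = Psi1 p (p ^ k)%N (Psi_upto p r A f k).
Proof. by rewrite /Psi_upto -addn1 iotaD foldl_cat. Qed.

Lemma ext_Psi_upto_before (p r k j h : nat) (A : zmodType)
    (f : SN (p ^ r)%N -> A) : prime p -> (k < j)%N ->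
  ext (Psi_upto p r A f k) ((p ^ j)%N, h) = ext f ((p ^ j)%N, h).
Proof.
move=> pp; elim: k => [//|k IH] kj.
by rewrite Psi_uptoS ext_Psi1_far ?IH //; lia.
Qed.

Lemma ext_Psi_upto_after (p r k j h : nat) (A : zmodType)
    (f : SN (p ^ r)%N -> A) : prime p -> (j < k)%N ->
  ext (Psi_upto p r A f k) ((p ^ j)%N, h)
  = ext (Psi_upto p r A f j.+1) ((p ^ j)%N, h).
Proof.
move=> pp; elim: k => [//|k IH]; rewrite ltnS leq_eqVlt => /orP[/eqP->//|jk].
by rewrite Psi_uptoS ext_Psi1_far ?IH //; lia.
Qed.

Theorem theorem1p18 (p r : nat) (p_prime : prime p) (p_odd : odd p)
    (r_ge2 : (2 <= r)%N)
    (A : zmodType) (hA : A = rat :> zmodType \/ A = ratZ)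
    (f : SN (p ^ r)%N -> A) (a : nat) (a_ge1 : (1 <= a)%N)
    (h1 : forall s : SN (p ^ r)%N, Psi p r f s = 0)
    (h2 : forall s : SN (p ^ r)%N, s \notin calA p (p ^ r)%N a -> f s = 0) :
  forall s : SN (p ^ r)%N, f s = 0.
Proof.
pose g j h := ext (Psi_upto p r A f j) ((p ^ j)%N, h).
pose F j h := ext f ((p ^ j)%N, h).
have F_eq0 : forall j h, (j < r)%N -> (0 < h <= p ^ (r - j)./2)%N -> F j h = 0.
  apply: (periodic_recursion_eq0 p r a A F g) => //.
  - move=> j h jr hr; rewrite /g Psi_uptoS ext_Psi1_next //.
    by rewrite ext_Psi_upto_before.
  - (* Level j is final after the operator of index j, so the hypothesis on
       Psi f says that g j h - g j h' = 0. *)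
    move=> j h jr hr; have jr0 := ltnW jr.
    have [h' h'P gE] := ext_Psi1_base p r j h A (Psi_upto p r A f j) p_prime jr hr.
    exists h' => //; apply/eqP; rewrite -subr_eq0 -gE -Psi_uptoS.
    rewrite -(ext_Psi_upto_after p r r.-1) //; last by lia.
    by rewrite /ext; case: insubP => // s _ _; rewrite [Psi_upto _ _ _ _ _ _]h1.
  - move=> j h jr hr hv.
    have xS : inS (p ^ r)%N ((p ^ j)%N, h) by rewrite inS_pexp.
    rewrite /F (ext_Sub _ _ _ _ xS); apply: h2.
    rewrite inE /Sm /Sh /= ell_pexp ?(ltnW jr) // pfactorK //.
    by move: hv; lia.
move=> s; have [j jr sj] := Sm_pexp p r s p_prime.
have sE : val s = ((p ^ j)%N, Sh s) by rewrite -sj /Sm /Sh; case: (val s).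
rewrite -ext_val sE; apply: F_eq0 => //.
by rewrite -inS_pexp // -sE; apply: valP s.
Qed.
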